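(* Let $\mathrm{Pen}(x)=\sum_{i=1}^d p(|x_i|)$ for $x\in\mathbb{R}^d$, where $p:[0,\infty)\to[0,\infty)$ satisfies: $p(0)=0$ and $p$ is nondecreasing; $p$ is concave (so $t\mapsto p(t)/t$ is nonincreasing); $t\mapsto p(t)+\frac{\mu}{2}t^2$ is convex (for a constant $\mu\ge0$); and $p$ is differentiable on $t>0$ with $\lim_{t\searrow0}p'(t)=1$. Let $c>0$ and $\mathcal{C}=\{x\in\mathbb{R}^d:\mathrm{Pen}(x)\le c\}$. Then, with respect to the norm $\|\cdot\|=\|\cdot\|_1$ and its dual $\|\cdot\|^*=\|\cdot\|_\infty$, the local concavity coefficients of $\mathcal{C}$ satisfy, for $x\in\mathcal{C}$, $$\begin{cases}\gamma_x(\mathcal{C})\le\dfrac{\mu/2}{p'(x_{\min})},&\text{if }\mathrm{Pen}(x)=c,\\[2mm]\gamma_x(\mathcal{C})=0,&\text{if }\mathrm{Pen}(x)<c,\end{cases}$$ where for any $x\in\mathbb{R}^d\setminus\{0\}$, $x_{\min}$ is the magnitude of its smallest (in magnitude) nonzero entry, and the bound is read as $\infty$ if $p'(x_{\min})=0$.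
   Context: $P_{\mathcal{C}}(z)\in\arg\min_{x\in\mathcal{C}}\|x-z\|_2$; if the minimizer is non-unique, $P_{\mathcal{C}}(z)$ denotes any minimizer, claims involving it are to hold for every choice, and ''$P_{\mathcal{C}}(z)=x$'' means that $x$ is a minimizer. Degenerate points: $\mathcal{C}_{\mathrm{dgn}}=\{x\in\mathcal{C}:P_{\mathcal{C}}\text{ is not continuous over any neighborhood of }x\}$. Local concavity coefficients: $\gamma_x(\mathcal{C})=\infty$ if $x\in\mathcal{C}_{\mathrm{dgn}}$, and for $x\in\mathcal{C}\setminus\mathcal{C}_{\mathrm{dgn}}$, $\gamma_x(\mathcal{C})$ is the smallest $\gamma\in[0,\infty]$ such that $\langle y-x,z-x\rangle\le\gamma\|z-x\|^*\|y-x\|_2^2$ for all $y\in\mathcal{C}$ and all $z\in\mathbb{R}^d$ with $P_{\mathcal{C}}(z)=x$. *)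

(* Defs.v *)
From HB Require Import structures.
From mathcomp Require Import all_boot all_order all_algebra.
From mathcomp Require Import all_classical all_reals all_analysis.

Set Implicit Arguments.
Unset Strict Implicit.
Unset Printing Implicit Defensive.

Import Order.TTheory GRing.Theory Num.Theory.
Import numFieldNormedType.Exports.

Local Open Scope classical_set_scope.
Local Open Scope ring_scope.

(* The norm `|x| of 'rV[R]_d is the l_infinity norm; its topology, used for    *)
(* continuity below, is that of the Euclidean norm.                            *)

Section LocalConcavity.
Variables (R : realType) (d : nat).
Implicit Types (x y z : 'rV[R]_d) (C : set 'rV[R]_d).
Implicit Types (N : 'rV[R]_d -> R) (P : 'rV[R]_d -> 'rV[R]_d).

Definition dotp x y : R := \sum_(i < d) x 0 i * y 0 i.

Definition l1norm x : R := \sum_(i < d) `|x 0 i|.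

Definition l2norm x : R := Num.sqrt (\sum_(i < d) x 0 i ^+ 2).

Definition dual_norm N z : R := sup [set dotp x z | x in [set x | N x <= 1]].

(* x is one of the possibly several minimizers defining P_C(z). *)
Definition is_proj C z x : Prop :=
  C x /\ forall y, C y -> l2norm (x - z) <= l2norm (y - z).

(* A choice of one minimizer for every z. *)
Definition projection_map C P : Prop := forall z, is_proj C z (P z).

(* Meant for P with projection_map C P. Continuity over a neighborhood of x    *)
(* means continuity of P at every point of that neighborhood.                  *)
Definition degenerate C P : set 'rV[R]_d :=
  [set x | C x /\ ~ \forall z \near x, {for z, continuous P}].

(* Since +oo * 0 = 0 in \bar R, g = +oo always satisfies this when N is a norm. *)
Definition concavity_bound N C x (g : \bar R) : Prop :=
  forall y z, C y -> is_proj C z x ->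
    ((dotp (y - x) (z - x))%:E <=
       g * (dual_norm N (z - x))%:E * (l2norm (y - x) ^+ 2)%:E)%E.

(* The infimum is a minimum: see local_concavity_l1_attained. *)
Definition local_concavity N C P x : \bar R :=
  if x \in degenerate C P then +oo%E
  else ereal_inf [set g : \bar R | (0 <= g)%E /\ concavity_bound N C x g].

Definition Pen (p : R -> R) x : R := \sum_(i < d) p `|x 0 i|.

Definition Pen_ball (p : R -> R) (c : R) : set 'rV[R]_d := [set x | Pen p x <= c].

(* Meaningful for x != 0 only (inf set0 = 0). *)
Definition xmin x : R := inf [set `|x 0 i| | i in [set i | x 0 i != 0]].

Lemma coord_le_norm x i : `|x 0 i| <= `|x|.
Proof.
rewrite [leRHS]/Num.norm /= mx_normrE; apply/bigmax_geP; right => /=.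
by exists (0, i).
Qed.

Lemma dotp0l x : dotp 0 x = 0.
Proof. by rewrite /dotp big1 // => i _; rewrite mxE mul0r. Qed.

Lemma dotp0r x : dotp x 0 = 0.
Proof. by rewrite /dotp big1 // => i _; rewrite mxE mulr0. Qed.

Lemma l2norm_eq0 x : l2norm x = 0 -> x = 0.
Proof.
have s0 : 0 <= \sum_(i < d) x 0 i ^+ 2 by apply: sumr_ge0 => i _; exact: sqr_ge0.
move=> /eqP; rewrite sqrtr_eq0 => sle.
have /eqP : \sum_(i < d) x 0 i ^+ 2 = 0 by apply/le_anti/andP.
rewrite psumr_eq0 => [/allP xi0|i _]; last exact: sqr_ge0.
apply/rowP => i; rewrite mxE; apply/eqP.
by have := xi0 i (mem_index_enum i); rewrite /= sqrf_eq0.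
Qed.

Lemma dual_norm_l1 z : dual_norm l1norm z = `|z|.
Proof.
have ub : ubound [set dotp x z | x in [set x | l1norm x <= 1]] `|z|.
  move=> _ [x /= x1 <-]; apply: (le_trans (ler_norm _)).
  apply: (le_trans (ler_norm_sum _ _ _)).
  apply: (@le_trans _ _ (l1norm x * `|z|)); last first.
    by rewrite -[leRHS]mul1r ler_wpM2r.
  rewrite /l1norm mulr_suml; apply: ler_sum => i _.
  by rewrite normrM ler_wpM2l // coord_le_norm.
apply/le_anti/andP; split.
  apply: ge_sup => //; exists (dotp 0 z), 0 => //=.
  by rewrite /l1norm big1 // => i _; rewrite mxE normr0.
have [->|z0] := eqVneq `|z| 0.
  apply: ub_le_sup; first by exists `|z|.
  exists 0; last exact: dotp0l.
  by rewrite /= /l1norm big1 // => i _; rewrite mxE normr0.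
have [[i0 i] zi] := mx_norm_neq0 z0.
have {}zi : `|z| = `|z 0 i| by rewrite [LHS]zi /= (ord1 i0).
apply: ub_le_sup; first by exists `|z|.
exists (Num.sg (z 0 i) *: delta_mx 0 i).
  rewrite /= /l1norm (bigD1 i) //= big1 => [|j /negPf ji].
    by rewrite !mxE !eqxx mulr1 addr0 normr_sg lern1; case: eqP.
  by rewrite !mxE ji andbF mulr0 normr0.
rewrite /dotp (bigD1 i) //= big1 => [|j /negPf ji].
  by rewrite !mxE !eqxx mulr1 addr0 -normrEsg zi.
by rewrite !mxE ji andbF mulr0 mul0r.
Qed.

Lemma local_concavity_l1_attained C P x : ~ degenerate C P x ->
  (0 <= local_concavity l1norm C P x)%E /\
  concavity_bound l1norm C x (local_concavity l1norm C P x).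
Proof.
move=> ndx; rewrite /local_concavity; case: ifPn => [/set_mem //|_].
set S := [set g : \bar R | _]; split; first by apply/ereal_infP => g [].
move=> y z Cy zx; rewrite dual_norm_l1.
have [/l2norm_eq0 yx|yx] := eqVneq (l2norm (y - x)) 0.
  by rewrite yx dotp0l /l2norm big1 ?sqrtr0 ?expr0n ?mule0 // => i _;
    rewrite mxE expr0n.
have [/normr0_eq0 ->|zx0] := eqVneq `|z - x| 0.
  by rewrite dotp0r normr0 mule0 mul0e.
have ab : 0 < `|z - x| * l2norm (y - x) ^+ 2.
  apply: mulr_gt0; first by rewrite lt0r zx0 normr_ge0.
  by rewrite exprn_gt0 // lt0r yx sqrtr_ge0.
rewrite -muleA -EFinM -lee_pdivrMr //.
apply/ereal_infP => g [g0 /(_ y z Cy zx)].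
by rewrite dual_norm_l1 -muleA -EFinM -lee_pdivrMr.
Qed.

Lemma xmin_attained x : x != 0 ->
  (exists2 i, x 0 i != 0 & xmin x = `|x 0 i|) /\
  forall j, x 0 j != 0 -> xmin x <= `|x 0 j|.
Proof.
move=> x0; have [i xi] : exists i, x 0 i != 0.
  apply/existsP; apply: contra_neqT x0 => /existsPn x0.
  by apply/rowP => i; rewrite mxE; apply/eqP; rewrite -[_ == _]negbK.
have [k xk kmin] := @arg_minP _ _ _ i (fun i => x 0 i != 0) (fun i => `|x 0 i|) xi.
suff E : xmin x = `|x 0 k| by split; [exists k | move=> j xj; rewrite E kmin].
apply/le_anti/andP; split.
  by apply: ge_inf; [exists 0 => _ [j _ <-] | exists k].
by apply: lb_le_inf; [exists `|x 0 k|, k | move=> _ [j xj <-]; exact: kmin].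
Qed.

End LocalConcavity.

(* Main.v *)
(* Write q t = p'(t) for t > 0 and q 0 = 1. Concavity and weak convexity give   *)
(* p t + q t (s - t) - mu/2 (s - t)^2 <= p s <= p t + q t (s - t) on [0, +oo[.  *)
(* If u = P_C(z) and u_k != 0, then C contains u + t w for small t > 0 as soon  *)
(* as the directional derivative D(w) of Pen at u is <= 0. Correcting an        *)
(* arbitrary w along e_k, on which D is linear, gives                           *)
(* <w, z - u> <= lambda D(w) with lambda q(|u_k|) <= |z - u|_oo, and            *)
(* D(y - u) <= mu/2 |y - u|_2^2 when Pen u = c and y is in C. This bounds the   *)
(* concavity by mu / (2 q(|u_k|)). As q is mu-Lipschitz, one index k serves for *)
(* all u near x, and adding the two inequalities for a pair of projections      *)
(* shows that P is Lipschitz near x, so that x is not degenerate.               *)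

Require Import Defs.
From HB Require Import structures.
From mathcomp Require Import all_boot all_order all_algebra.
From mathcomp Require Import all_classical all_reals all_analysis.
From mathcomp Require Import ring lra.

Set Implicit Arguments.
Unset Strict Implicit.
Unset Printing Implicit Defensive.

Import Order.TTheory GRing.Theory Num.Theory.
Import numFieldNormedType.Exports.

Local Open Scope classical_set_scope.
Local Open Scope ring_scope.

(** [Pen] is neither smooth nor convex, but along a coordinate k with u_k nonzero it is
    differentiable. If moreover p'(|u_k|) > 0, this yields a Lagrange multiplier for u = P(z):
    [is_proj_dotp_le] gives <w, z - u> <= lambda D(w), with lambda at most |z - u|_oo / p'(|u_k|).
    On the boundary, weak convexity bounds D(y - u) by mu/2 |y - u|_2^2 ([Pen_ge]), and the product
    is the concavity bound ([is_proj_concavity]); inside, only z = u projects to u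
    ([is_proj_Pen_lt]). A degenerate point would have coefficient +oo, so continuity of the
    projection near x is owed as well: [nondegenerate_of_concavity_bound] derives it from a
    concavity bound uniform in u near x. *)

(** Convexity bounds the difference quotients of step h in (0, 1] from t towards s by f s - f t;
    then h tends to 0. *)
Lemma convex_tangent_le (R : realType) (f : R -> R) (t s : R) :
  convex_function (`[0, +oo[%classic : set R) f ->
  0 <= t -> 0 <= s -> derivable f t 1 -> f t + derive1 f t * (s - t) <= f s.
Proof.
move=> cf t0 s0 df.
have dft : differentiable f t by exact/derivable1_diffP.
have dfs : derivable f t (s - t) by exact: diff_derivable.
have -> : derive1 f t * (s - t) = 'D_(s - t) f t.
  rewrite derive1E !deriveE // mulrC -[RHS](congr1 _ (mulr1 (s - t))).
  by rewrite -[(s - t) * 1]/((s - t) *: (1 : R)) linearZ.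
rewrite -lerBrDl; apply: (cvgr_to_le (cvg_dnbhs_at_right dfs)).
near=> h.
have h0 : 0 < h by near: h; exact: nbhs_right_gt.
have h1 : h <= 1 by near: h; exact: nbhs_right_le.
have sD : s \in (`[0, +oo[%classic : set R) by rewrite inE /= in_itv /= s0.
have tD : t \in (`[0, +oo[%classic : set R) by rewrite inE /= in_itv /= t0.
have := cf (Itv01 (ltW h0) h1) s t sD tD.
rewrite !convRE /= /GRing.scale /= => fh.
rewrite mulrC ler_pdivrMr // lerBlDr.
have <- : h * s + unstable.onem h * t = h * (s - t) + t.
  by rewrite /unstable.onem; ring.
by apply: le_trans fh _; rewrite /unstable.onem; lra.
Unshelve. all: by end_near. Qed.

(** * Inner product, first-order optimality and continuity of projections *)

Section RowVectors.
Variables (R : realType) (d : nat).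
Implicit Types (x y z u v w : 'rV[R]_d) (C : set 'rV[R]_d) (P : 'rV[R]_d -> 'rV[R]_d).

Lemma dotpC v w : dotp v w = dotp w v.
Proof. by apply: eq_bigr => i _; rewrite mulrC. Qed.

Lemma dotpDl u v w : dotp (u + v) w = dotp u w + dotp v w.
Proof. by rewrite -big_split; apply: eq_bigr => i _; rewrite mxE mulrDl. Qed.

Lemma dotpDr u v w : dotp u (v + w) = dotp u v + dotp u w.
Proof. by rewrite !(dotpC u) dotpDl. Qed.

Lemma dotpZl (a : R) v w : dotp (a *: v) w = a * dotp v w.
Proof. by rewrite mulr_sumr; apply: eq_bigr => i _; rewrite mxE mulrA. Qed.

Lemma dotpZr (a : R) v w : dotp v (a *: w) = a * dotp v w.
Proof. by rewrite dotpC dotpZl dotpC. Qed.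

Lemma dotpNl v w : dotp (- v) w = - dotp v w.
Proof. by rewrite -scaleN1r dotpZl mulN1r. Qed.

Lemma dotpNr v w : dotp v (- w) = - dotp v w.
Proof. by rewrite dotpC dotpNl dotpC. Qed.

Definition dotpE := (dotpDl, dotpDr, dotpNl, dotpNr, dotpZl, dotpZr).

Lemma dotp_delta (a : R) i v : dotp (a *: delta_mx 0 i) v = a * v 0 i.
Proof.
rewrite dotpZl; congr (_ * _); rewrite /dotp (bigD1 i) //= big1 => [|j /negPf ji].
  by rewrite mxE !eqxx mul1r addr0.
by rewrite mxE ji andbF mul0r.
Qed.

Lemma dotp_ge0 v : 0 <= dotp v v.
Proof. by apply: sumr_ge0 => i _; rewrite -expr2 sqr_ge0. Qed.

Lemma sqr_l2norm v : l2norm v ^+ 2 = dotp v v.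
Proof.
have E : \sum_(i < d) v 0 i ^+ 2 = dotp v v by apply: eq_bigr => i _; rewrite expr2.
by rewrite /l2norm E sqr_sqrtr // dotp_ge0.
Qed.

Lemma dotp_le_norm v w : dotp v w <= d%:R * (`|v| * `|w|).
Proof.
rewrite mulr_natl -[X in _ *+ X]card_ord -sumr_const; apply: ler_sum => i _.
by rewrite (le_trans (ler_norm _)) // normrM ler_pM // coord_le_norm.
Qed.

Lemma norm_le_dotp v : `|v| ^+ 2 <= dotp v v.
Proof.
have [->|v0] := eqVneq `|v| 0; first by rewrite expr0n dotp_ge0.
have [[i0 i] vi] := mx_norm_neq0 v0.
have {}vi : `|v| = `|v 0 i| by rewrite [LHS]vi /= (ord1 i0).
rewrite vi real_normK ?num_real // /dotp (bigD1 i) //= -expr2 lerDl.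
by apply: sumr_ge0 => j _; rewrite -expr2 sqr_ge0.
Qed.

Lemma is_proj_dotp C z u y : is_proj C z u -> C y ->
  dotp (u - z) (u - z) <= dotp (y - z) (y - z).
Proof.
by move=> [_ /(_ y)] uz /uz; rewrite -!sqr_l2norm ler_sqr ?nnegrE ?sqrtr_ge0.
Qed.

(** If <w, z - u> were positive, a small step along w would stay in C and come closer to z, since |u
    + t w - z|^2 = |u - z|^2 - 2 t <w, z - u> + t^2 |w|^2. *)
Lemma is_proj_feasible C z u w : is_proj C z u ->
  (\forall t \near 0^'+, C (u + t *: w)) -> dotp w (z - u) <= 0.
Proof.
move=> uz Cw; rewrite leNgt; apply/negP => w0.
near (0 : R)^'+ => t.
have t0 : 0 < t by near: t; exact: nbhs_right_gt.
have Ct : C (u + t *: w) by near: t.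
have tw : t * (dotp w w + 1) <= dotp w (z - u).
  rewrite -ler_pdivlMr ?ltr_wpDl ?dotp_ge0 //; near: t; apply: nbhs_right_le.
  by rewrite divr_gt0 // ltr_wpDl ?dotp_ge0.
move: tw (w0) (is_proj_dotp uz Ct); rewrite -[z - u]opprB addrAC.
by move: (u - z) => v; rewrite !dotpE (dotpC v w); nra.
Unshelve. all: by end_near. Qed.

(** For z near x the residual z - P z is small, so the factor g |z - P z| drops to 1/4. Adding the
    inequalities of two projections then absorbs their quadratic terms and makes P Lipschitz near
    x. *)
Lemma nondegenerate_of_concavity_bound C P x (g : R) : 0 <= g -> projection_map C P ->
  C x ->
  (\forall u \near x, forall y z, C y -> is_proj C z u ->
     dotp (y - u) (z - u) <= g * `|z - u| * dotp (y - u) (y - u)) ->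
  ~ degenerate C P x.
Proof.
move=> g0 PC Cx /nbhs_ballP[r /= r0 gr] [_]; apply.
(* The norm is the sup norm, so Cauchy-Schwarz costs a factor d; d + 1 keeps K >= 1 when d = 0. *)
have [K K1 dotK] : exists2 K : R, 1 <= K &
    forall v w : 'rV[R]_d, dotp v w <= K * (`|v| * `|w|).
  exists (d%:R + 1) => [|v w]; first by rewrite lerDr.
  by rewrite (le_trans (dotp_le_norm _ _)) // ler_wpM2r ?mulr_ge0 // lerDl.
have Px z : `|P z - z| <= K * `|z - x|.
  rewrite -(@ler_pXn2r _ 2) // ?nnegrE ?mulr_ge0 //; last by rewrite (le_trans ler01).
  apply: (le_trans (norm_le_dotp _)); apply: (le_trans (is_proj_dotp (PC z) Cx)).
  apply: (le_trans (dotK _ _)); rewrite distrC exprMn -expr2 ler_wpM2r ?sqr_ge0 //.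
  by rewrite expr2 ler_peMr // (le_trans ler01).
have K0 : 0 < K by rewrite (lt_le_trans ltr01).
(* The first bound keeps P z within r of x, the second makes g |z - P z| <= 1/4. *)
pose e := Num.min (r / (K + 1)) (1 / (4 * K * (g + 1))).
have g1 : 0 < g + 1 by rewrite ltr_wpDl.
have Kg : 0 < 4 * K * (g + 1) by rewrite !mulr_gt0.
have e0 : 0 < e.
  rewrite lt_min; apply/andP; split; first exact: divr_gt0 r0 (addr_gt0 K0 ltr01).
  by rewrite divr_gt0 // !mulr_gt0.
have gP z y : `|z - x| < e -> C y ->
    dotp (y - P z) (z - P z) <= 1 / 4 * dotp (y - P z) (y - P z).
  rewrite lt_min => /andP[zr zg] Cy.
  apply: (@le_trans _ _ (g * `|z - P z| * dotp (y - P z) (y - P z))).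
    apply: gr => //; rewrite -ball_normE /= distrC.
    have -> : P z - x = (P z - z) + (z - x) by rewrite addrA subrK.
    apply: (le_lt_trans (ler_normD _ _)).
    move: zr; rewrite ltr_pdivlMr ?addr_gt0 // => zr.
    have := Px z; lra.
  rewrite ler_wpM2r ?dotp_ge0 // distrC.
  apply: (@le_trans _ _ ((g + 1) * (K * `|z - x|))).
    by rewrite ler_pM // lerDl.
  move: zg; rewrite ltr_pdivlMr //; lra.
have lip z w : `|z - x| < e -> `|w - x| < e -> `|P z - P w| <= 2 * K * `|z - w|.
  move=> ze we.
  have D : dotp (P z - P w) (P z - P w) <= 2 * dotp (P z - P w) (z - w).
    have := gP z (P w) ze (PC w).1; have := gP w (P z) we (PC z).1.
    have -> : z - P z = z - w + (w - P w) - (P z - P w).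
      by apply/rowP => i; rewrite !mxE; ring.
    rewrite -(opprB (P z)) !dotpE; lra.
  have [->|n0] := eqVneq `|P z - P w| 0; first by rewrite !mulr_ge0 ?(ltW K0).
  have n1 : 0 < `|P z - P w| by rewrite lt0r n0 normr_ge0.
  rewrite -(ler_pM2l n1) -expr2; apply: (le_trans (norm_le_dotp _)).
  apply: (le_trans D); have := dotK (P z - P w) (z - w); lra.
have near_x : \forall z \near x, `|z - x| < e.
  by apply/nbhs_ballP; exists e => //= z; rewrite -ball_normE /= distrC.
(* [near_join] also puts a whole neighborhood of z into the ball, as needed for w tending to z. *)
apply: filterS2 near_x (near_join near_x) => z ze ze'.
apply/(@cvgrPdist_le _ _ _ (nbhs z)) => eps eps0; near=> w.
have we : `|w - x| < e by near: w.
apply: (le_trans (lip _ _ ze we)); rewrite -ler_pdivlMl ?mulr_gt0 //.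
near: w; apply/nbhs_ballP; exists ((2 * K)^-1 * eps) => /=.
  by rewrite mulr_gt0 // invr_gt0 mulr_gt0.
by move=> w; rewrite -ball_normE => /ltW.
Unshelve. all: by end_near. Qed.
End RowVectors.

(** * One-sided derivative of the absolute value *)

Section AbsoluteValue.
Variable R : realType.
Implicit Types a b t : R.

(** The derivative at a in direction b, linear in b only for nonzero a. *)
Definition abs_der a b : R := if a == 0 then `|b| else Num.sg a * b.

Lemma abs_der_le a b : abs_der a b <= `|a + b| - `|a|.
Proof.
rewrite /abs_der; case: eqVneq => [->|a0]; first by rewrite add0r normr0 subr0.
have [a0'|a0'|/eqP] := ltrgt0P a; last by rewrite (negPf a0).
  by rewrite gtr0_sg // mul1r; have := ler_norm (a + b); lra.
by rewrite ltr0_sg //; have := ler_norm (- (a + b)); rewrite normrN; lra.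
Qed.

Lemma abs_der_eq a b : (a != 0 -> `|b| <= `|a|) -> `|a + b| - `|a| = abs_der a b.
Proof.
rewrite /abs_der; case: eqVneq => [->|a0 /(_ isT)]; first by rewrite add0r normr0 subr0.
rewrite ler_norml => /andP[].
have [a0'|a0'|/eqP] := ltrgt0P a; last by rewrite (negPf a0).
  by move=> *; rewrite gtr0_sg // ger0_norm; lra.
by move=> *; rewrite ltr0_sg // ler0_norm; lra.
Qed.

Lemma abs_derZ t a b : 0 <= t -> abs_der a (t * b) = t * abs_der a b.
Proof.
by move=> t0; rewrite /abs_der; case: eqP => _; [rewrite normrM ger0_norm | rewrite mulrCA].
Qed.

Lemma abs_derD a b b' : a != 0 -> abs_der a (b + b') = abs_der a b + Num.sg a * b'.
Proof. by rewrite /abs_der => /negPf ->; rewrite mulrDr. Qed.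

End AbsoluteValue.

(** * Projections onto a sublevel set of [Pen], for a slope function q of p *)

Section PenaltyBall.
Variables (R : realType) (d : nat) (p q : R -> R) (mu c : R).
Hypothesis mu_ge0 : 0 <= mu.
Hypothesis q_ge0 : forall t, 0 <= t -> 0 <= q t.
Hypothesis p_le : forall t s, 0 <= t -> 0 <= s -> p s <= p t + q t * (s - t).
Hypothesis p_ge : forall t s, 0 <= t -> 0 <= s ->
  p t + q t * (s - t) - mu / 2 * (s - t) ^+ 2 <= p s.
Implicit Types (y z u w : 'rV[R]_d).

(** Adding [p_le] at (t, s) and (s, t) shows that q is nonincreasing; adding [p_ge] likewise limits
    its decrease to mu |s - t|. *)
Lemma slope_lipschitz t s : 0 <= t -> 0 <= s -> q t - mu * `|s - t| <= q s.
Proof.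
move=> t0 s0; have pts := p_le t0 s0; have pst := p_le s0 t0.
have pts' := p_ge t0 s0; have pst' := p_ge s0 t0.
have [st|st|->] := ltgtP s t; last by rewrite subrr normr0; lra.
  have : q t <= q s by rewrite -subr_ge0 -(@pmulr_lge0 _ (t - s)) ?subr_gt0 //; lra.
  by have := mulr_ge0 mu_ge0 (normr_ge0 (s - t)); lra.
rewrite gtr0_norm ?subr_gt0 // -subr_ge0 -(@pmulr_lge0 _ (s - t)) ?subr_gt0 //; nra.
Qed.

Definition Pen_der u w : R := \sum_(i < d) q `|u 0 i| * abs_der (u 0 i) (w 0 i).

(** [p_ge] is applied coordinatewise; as q >= 0, |b| - |a| may be replaced by its smaller
    linearization, and its square is at most (b - a)^2. *)
Lemma Pen_ge u y : Pen p u + Pen_der u (y - u) - mu / 2 * dotp (y - u) (y - u) <= Pen p y.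
Proof.
rewrite /Pen /Pen_der /dotp mulr_sumr -big_split /= -sumrB; apply: ler_sum => i _.
rewrite !mxE; set a := u 0 i; set b := y 0 i.
have := p_ge (normr_ge0 a) (normr_ge0 b).
have := ler_wpM2l (q_ge0 (normr_ge0 a)) (abs_der_le a (b - a)).
rewrite addrCA subrr addr0.
have : (`|b| - `|a|) ^+ 2 <= (b - a) * (b - a).
  rewrite -expr2 -(real_normK (num_real (b - a))) -(real_normK (num_real (`|b| - `|a|))).
  by rewrite ler_sqr ?nnegrE // ler_dist_dist.
move=> /(ler_wpM2l (divr_ge0 mu_ge0 (ler0n _ 2))); lra.
Qed.

(** For small t no nonzero coordinate changes sign, so the expansion of the absolute values is
    exact. Concavity adds no quadratic remainder, so D(w) <= 0, without strictness, suffices for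
    feasibility. *)
Lemma Pen_le_near u w : \forall t \near 0^'+,
  0 < t /\ Pen p (u + t *: w) <= Pen p u + t * Pen_der u w.
Proof.
have small : \forall t \near 0^'+, forall i, u 0 i != 0 -> `|t * w 0 i| <= `|u 0 i|.
  apply: filter_forall => i; have [_|ui] := eqVneq (u 0 i) 0.
    exact: nearW.
  near=> t; move=> _.
  have t0 : 0 < t by near: t; exact: nbhs_right_gt.
  have : t * (`|w 0 i| + 1) <= `|u 0 i|.
    rewrite -ler_pdivlMr ?ltr_wpDl //; near: t; apply: nbhs_right_le.
    by rewrite divr_gt0 ?normr_gt0 // ltr_wpDl.
  by rewrite normrM gtr0_norm //; lra.
near=> t.
have t0 : 0 < t by near: t; exact: nbhs_right_gt.
split=> //; rewrite /Pen /Pen_der mulr_sumr -big_split; apply: ler_sum => i _ /=.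
rewrite !mxE mulrCA -abs_derZ ?(ltW t0) // -abs_der_eq; first exact: p_le.
by move: i; near: t.
Unshelve. all: by end_near. Qed.

Lemma Pen_lt_near u : Pen p u < c -> \forall z \near u, Pen p z < c.
Proof.
move=> uc; pose Q := \sum_(i < d) q `|u 0 i|.
have Q0 : 0 <= Q by apply: sumr_ge0 => i _; exact: q_ge0.
have Q1 : 0 < Q + 1 by exact: ltr_wpDl.
apply/nbhs_ballP; exists ((c - Pen p u) / (Q + 1)) => /=.
  by rewrite divr_gt0 ?subr_gt0.
move=> z; rewrite -ball_normE /= distrC ltr_pdivlMr // => zu.
have : Pen p z <= Pen p u + Q * `|z - u|.
  rewrite /Pen /Q mulr_suml -big_split; apply: ler_sum => i _ /=.
  apply: le_trans (p_le (normr_ge0 (u 0 i)) (normr_ge0 _)) _; rewrite lerD2l.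
  rewrite ler_wpM2l ?q_ge0 //.
  apply: le_trans (coord_le_norm (z - u) i); rewrite !mxE.
  by apply: le_trans (ler_norm _) (ler_dist_dist _ _).
have := normr_ge0 (z - u); lra.
Qed.

(** With slack in the constraint every direction is feasible, in particular z - u. *)
Lemma is_proj_Pen_lt z u : is_proj (Pen_ball p c) z u -> Pen p u < c -> z = u.
Proof.
move=> uz uc; have : dotp (z - u) (z - u) <= 0.
  apply: (is_proj_feasible uz); near=> t; rewrite /Pen_ball /=.
  have [t0 /le_trans ->] // : 0 < t /\
      Pen p (u + t *: (z - u)) <= Pen p u + t * Pen_der u (z - u).
    by near: t; exact: Pen_le_near.
  rewrite -lerBrDl; set D := Pen_der _ _.
  have : t * (`|D| + 1) <= c - Pen p u.
    rewrite -ler_pdivlMr ?ltr_wpDl //; near: t; apply: nbhs_right_le.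
    by rewrite divr_gt0 ?subr_gt0 // ltr_wpDl.
  have := ler_norm D; nra.
move=> /(le_trans (norm_le_dotp _)); rewrite exprn_even_le0 //= normr_eq0 subr_eq0.
by move/eqP.
Unshelve. all: by end_near. Qed.

(* Moving along coordinate k, where Pen is smooth, turns any direction w into *)
(* one that is feasible to first order, at the price dotp = lambda * Pen_der. *)
Lemma is_proj_dotp_le z u w k : is_proj (Pen_ball p c) z u ->
  u 0 k != 0 -> 0 < q `|u 0 k| ->
  exists lambda, [/\ 0 <= lambda, lambda * q `|u 0 k| <= `|z - u| &
    dotp w (z - u) <= lambda * Pen_der u w].
Proof.
move=> uz uk qk; have uc : Pen p u <= c := uz.1.
pose s := Num.sg (u 0 k); have ss : s * s = 1 by rewrite -expr2 sqr_sg uk.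
have descent v : Pen_der u v <= 0 -> dotp v (z - u) <= 0.
  move=> Dv; apply: (is_proj_feasible uz).
  apply: filterS (Pen_le_near u v) => t [t0 /le_trans]; apply.
  have := mulr_ge0_le0 (ltW t0) Dv; lra.
have Pen_derD v a : Pen_der u (v + a *: delta_mx 0 k) =
    Pen_der u v + q `|u 0 k| * (s * a).
  rewrite /Pen_der (bigD1 k) //= [in RHS](bigD1 k) //= !mxE !eqxx mulr1 abs_derD //.
  rewrite mulrDr addrAC; congr (_ + _ + _); apply: eq_bigr => i /negPf ik.
  by rewrite !mxE ik andbF mulr0 addr0.
(* The multiplier is read off the stationarity equation in coordinate k. It is nonnegative because
   shrinking |u_k| lowers [Pen] to first order. *)
exists (s * (z - u) 0 k / q `|u 0 k|); split.
- rewrite divr_ge0 ?(ltW qk) // -oppr_le0 -mulNr -dotp_delta.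
  apply: descent; rewrite -[_ *: _]add0r Pen_derD [Pen_der u 0]big1 => [|i _].
    by rewrite mulrN ss add0r mulrN1 oppr_le0 ltW.
  by rewrite mxE /abs_der normr0 mulr0 if_same mulr0.
- rewrite divfK ?gt_eqF // (le_trans (ler_norm _)) // normrM normr_sg uk mul1r.
  exact: coord_le_norm.
(* The multiple of e_k is chosen to make the corrected derivative exactly 0. *)
- have := descent (w + (- (s * Pen_der u w / q `|u 0 k|)) *: delta_mx 0 k).
  rewrite Pen_derD dotpDl dotp_delta.
  have -> : q `|u 0 k| * (s * - (s * Pen_der u w / q `|u 0 k|)) = - (s * s) * Pen_der u w.
    by field; rewrite gt_eqF.
  by rewrite ss mulN1r subrr lexx => /(_ isT); lra.
Qed.

Lemma is_proj_concavity z u y k : is_proj (Pen_ball p c) z u ->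
  u 0 k != 0 -> 0 < q `|u 0 k| -> Pen_ball p c y ->
  dotp (y - u) (z - u) <= mu / 2 / q `|u 0 k| * `|z - u| * dotp (y - u) (y - u).
Proof.
move=> uz uk qk; rewrite /Pen_ball /= => yc.
have := uz.1; rewrite /Pen_ball /= le_eqVlt => /predU1P[uc|/(is_proj_Pen_lt uz) ->]; last first.
  by rewrite subrr normr0 dotp0r mulr0 mul0r.
have [l [l0 lq /le_trans]] := is_proj_dotp_le (y - u) uz uk qk; apply.
apply: (@le_trans _ _ (l * (mu / 2 * dotp (y - u) (y - u)))).
  by rewrite ler_wpM2l //; have := Pen_ge u y; rewrite uc; lra.
rewrite mulrA ler_wpM2r ?dotp_ge0 // mulrC -mulrA ler_wpM2l ?divr_ge0 //.
by rewrite mulrC ler_pdivlMr.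
Qed.

End PenaltyBall.

(** * Tangent bounds for p on the closed half-line *)

Section Slope.
Variables (R : realType) (p : R -> R) (mu : R).
Hypothesis p_concave : convex_function (`[0, +oo[%classic : set R) (\- p).
Hypothesis p_weakly_convex :
  convex_function (`[0, +oo[%classic : set R) (fun t : R => p t + mu / 2 * t ^+ 2).
Hypothesis p_derivable : forall t : R, 0 < t -> derivable p t 1.
Hypothesis p0 : p 0 = 0.
Hypothesis p'_at_0 : derive1 p t @[t --> 0^'+] --> (1 : R).

(* The value 1 at t = 0 is the right derivative, where derive1 p 0 is junk. *)
Definition slope (t : R) : R := if t == 0 then 1 else derive1 p t.

Lemma le_tangent_pos t s : 0 < t -> 0 <= s -> p s <= p t + derive1 p t * (s - t).
Proof.
move=> t0 s0; have dp := p_derivable t0.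
have := convex_tangent_le p_concave (ltW t0) s0 (derivableN dp).
by rewrite derive1E deriveN // -derive1E /=; lra.
Qed.

Lemma ge_tangent_pos t s : 0 < t -> 0 <= s ->
  p t + derive1 p t * (s - t) - mu / 2 * (s - t) ^+ 2 <= p s.
Proof.
move=> t0 s0; have dp := p_derivable t0.
have dq : is_derive t 1 (fun t : R => p t + mu / 2 * t ^+ 2) (derive1 p t + mu * t).
  have dp' : is_derive t 1 p (derive1 p t) by rewrite derive1E; exact: derivableP.
  apply: is_derive_eq; rewrite /GRing.scale /=; lra.
have [dq1 dq2] := dq.
have := convex_tangent_le p_weakly_convex (ltW t0) s0 dq1.
by rewrite derive1E dq2; lra.
Qed.

Lemma le_tangent t s : 0 <= t -> 0 <= s -> p s <= p t + slope t * (s - t).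
Proof.
rewrite /slope le0r; case: eqVneq => [-> _|_ /=]; last exact: le_tangent_pos.
move=> s0; rewrite p0 add0r subr0 mul1r.
have id0 : t @[t --> (0 : R)^'+] --> (0 : R) by apply: cvg_at_right_filter; exact: cvg_id.
(* The lower tangent bound from h to 0 gives p h <= h p'(h) + mu/2 h^2, which eliminates p h before
   h tends to 0. *)
suff : derive1 p t * s + mu / 2 * (t * t) @[t --> 0^'+] --> 1 * s + mu / 2 * (0 * 0).
  rewrite !mul0r mulr0 addr0 mul1r => /cvgr_to_ge; apply.
  near=> h; have h0 : 0 < h by near: h; exact: nbhs_right_gt.
  by have := le_tangent_pos h0 s0; have := ge_tangent_pos h0 (lexx 0); rewrite p0; lra.
by apply: cvgD; [exact: cvgMl | apply: cvgMr; exact: cvgM].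
Unshelve. all: by end_near. Qed.

Lemma ge_tangent t s : 0 <= t -> 0 <= s ->
  p t + slope t * (s - t) - mu / 2 * (s - t) ^+ 2 <= p s.
Proof.
rewrite /slope le0r; case: eqVneq => [-> _|_ /=]; last exact: ge_tangent_pos.
move=> s0; rewrite p0 add0r subr0 mul1r.
have id0 : t @[t --> (0 : R)^'+] --> (0 : R) by apply: cvg_at_right_filter; exact: cvg_id.
have sub0 : s - t @[t --> (0 : R)^'+] --> s - 0 by apply: cvgB => //; exact: cvg_cst.
(* Here p h is eliminated by the upper tangent bound from h to 0, that is p h >= h p'(h). *)
suff : derive1 p t * s - mu / 2 * ((s - t) * (s - t)) @[t --> 0^'+] -->
    1 * s - mu / 2 * ((s - 0) * (s - 0)).
  rewrite subr0 mul1r => /cvgr_to_le; apply.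
  near=> h; have h0 : 0 < h by near: h; exact: nbhs_right_gt.
  by have := ge_tangent_pos h0 s0; have := le_tangent_pos h0 (lexx 0); rewrite p0; lra.
by apply: cvgB; [exact: cvgMl | apply: cvgMr; exact: cvgM].
Unshelve. all: by end_near. Qed.

End Slope.

(** * Coefficients at interior and boundary points *)

Theorem lemma9 (R : realType) (d : nat) (p : R -> R) (mu c : R)
    (P : 'rV[R]_d -> 'rV[R]_d)
    (p_ge0 : forall t : R, 0 <= t -> 0 <= p t)
    (p0 : p 0 = 0)
    (p_nondecreasing : {in `[0, +oo[ &, nondecreasing_fun p})
    (p_concave : convex_function (`[0, +oo[%classic : set R) (\- p))
    (mu_ge0 : 0 <= mu)
    (p_weakly_convex :
      convex_function (`[0, +oo[%classic : set R)
        (fun t : R => p t + mu / 2 * t ^+ 2))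
    (p_derivable : forall t : R, 0 < t -> derivable p t 1)
    (p'_at_0 : derive1 p t @[t --> 0^'+] --> (1 : R))
    (c_gt0 : 0 < c)
    (P_proj : projection_map (Pen_ball p c) P)
    (x : 'rV[R]_d) (Cx : Pen_ball p c x) :
  (Pen p x = c ->
    (local_concavity (@l1norm R d) (Pen_ball p c) P x <=
      if derive1 p (xmin x) == 0%R then +oo
      else (mu / 2 / derive1 p (xmin x))%:E)%E) /\
  (Pen p x < c -> local_concavity (@l1norm R d) (Pen_ball p c) P x = 0%E).
Proof.
have p_le := le_tangent p_concave p_weakly_convex p_derivable p0 p'_at_0.
have p_ge := ge_tangent p_concave p_weakly_convex p_derivable p0 p'_at_0.
have q_ge0 t : 0 <= t -> 0 <= slope p t.
  move=> t0; have t1 : 0 <= t + 1 by rewrite addr_ge0.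
  have := p_le _ _ t0 t1; have : p t <= p (t + 1).
    by apply: p_nondecreasing; rewrite ?in_itv /= ?t0 ?t1 // lerDl.
  lra.
split=> xc; last first.
  have bound0 (u : 'rV[R]_d) : Pen p u < c -> forall y z, Pen_ball p c y -> is_proj (Pen_ball p c) z u ->
      dotp (y - u) (z - u) <= 0 * `|z - u| * dotp (y - u) (y - u).
    move=> uc y z _ /(is_proj_Pen_lt p_le) -> //.
    by rewrite subrr dotp0r !mul0r.
  have ndx : ~ degenerate (Pen_ball p c) P x.
    apply: (nondegenerate_of_concavity_bound (lexx 0) P_proj Cx).
    exact: filterS bound0 (Pen_lt_near q_ge0 p_le xc).
  have [g0 _] := local_concavity_l1_attained ndx; apply/le_anti; rewrite g0 andbT.
  rewrite /local_concavity; case: ifPn => [/set_mem //|_].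
  apply: ereal_inf_lbound; split=> // y z yC zx.
  by rewrite dual_norm_l1 sqr_l2norm -!EFinM lee_fin bound0.
have x0 : x != 0.
  apply: contraTneq c_gt0 => x0; rewrite -xc x0 /Pen big1 ?ltxx // => i _.
  by rewrite mxE normr0 p0.
(* Every nonzero entry gives a bound; the smallest has the largest slope, hence the best bound. *)
have [[k xk ->] _] := xmin_attained x0; set a := `|x 0 k|.
have a0 : 0 < a by rewrite normr_gt0.
have qE : derive1 p a = slope p a by rewrite /slope gt_eqF.
rewrite {}qE; case: eqVneq => [_|qa]; first exact: leey.
have {}qa : 0 < slope p a by rewrite lt0r qa q_ge0 // ltW.
have ndx : ~ degenerate (Pen_ball p c) P x.
  (* Twice the final constant: near x the slope at |u_k| is only known to exceed half of that at a.
     The index k stays fixed, even if u has smaller nonzero entries. *)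
  apply: (@nondegenerate_of_concavity_bound _ _ _ _ _ (mu / slope p a)) => //.
    by rewrite divr_ge0 ?(ltW qa).
  (* Radius a keeps u_k nonzero; the other bound makes the slope loss mu |u - x| at most half of
     [slope p a]. *)
  apply/nbhs_ballP; exists (Num.min a (slope p a / (2 * (mu + 1)))) => /=.
    by rewrite lt_min a0 divr_gt0 // mulr_gt0 // ltr_wpDl.
  move=> u; rewrite -ball_normE /= distrC lt_min => /andP[ua uq] y z yC uz.
  have uxk : `|u 0 k - x 0 k| <= `|u - x|.
    by have := coord_le_norm (u - x) k; rewrite !mxE.
  have uk : u 0 k != 0.
    by apply: contraTneq ua => uk; rewrite -leNgt (le_trans _ uxk) // uk sub0r normrN.
  have qu : slope p a / 2 <= slope p `|u 0 k|.
    apply: le_trans (slope_lipschitz mu_ge0 p_le p_ge (ltW a0) (normr_ge0 _)).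
    have /(ler_wpM2l mu_ge0) := le_trans (ler_dist_dist (u 0 k) (x 0 k)) uxk.
    move: uq; rewrite ltr_pdivlMr ?mulr_gt0 ?ltr_wpDl //.
    have := normr_ge0 (u - x); rewrite -/a; lra.
  have qu0 : 0 < slope p `|u 0 k| by rewrite (lt_le_trans _ qu) // divr_gt0.
  apply: le_trans (is_proj_concavity mu_ge0 q_ge0 p_le p_ge uz uk qu0 yC) _.
  rewrite -!mulrA ler_wpM2l //.
  rewrite ![X in _ <= X]mulrA !mulrA !ler_wpM2r ?dotp_ge0 //.
  by rewrite -invfM lef_pV2 ?posrE ?mulr_gt0 // mulrC -ler_pdivrMr.
rewrite /local_concavity; case: ifPn => [/set_mem //|_].
apply: ereal_inf_lbound; split; first by rewrite lee_fin !divr_ge0 // ltW.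
move=> y z yC zx; rewrite dual_norm_l1 sqr_l2norm -!EFinM lee_fin.
by have := is_proj_concavity mu_ge0 q_ge0 p_le p_ge zx xk qa yC.
Qed.
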